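(* Let $(X,d)$ be a Busemann $p$-space. Let $C\subset X$ be a convex closed set in $X$ and $x\in X$. Then there exists a unique point $x_C\in C$ such that $$d(x_C,x)=\min_{y\in C}d(y,x)=d(C,x).$$ (The point $x_C$ is called the best approximation of $x$ in $C$.)
   Context: Here $p\ge 2$. A geodesic length space is a metric space $(X,d)$ in which the distance is the infimum of the lengths of rectifiable arcs joining given endpoints and any two points are joined by a shortest geodesic $\gamma:[0,1]\to X$ (parametrized proportionally to arc length, of length equal to the distance between its endpoints). A Busemann $p$-space is a geodesic length space for which there is a constant $K>0$ such that for all $x,y,z\in X$ and any geodesic $\gamma$ joining $y$ to $z$, $$\frac{1}{(2K)^p}d(y,z)^p\le\frac12\left(d(x,y)^p+d(x,z)^p\right)-d(x,\gamma(1/2))^p.$$ A set $C\subset X$ is convex if for all $x,y\in C$ the unique geodesic of $X$ joining $x$ to $y$ is fully contained in $C$. $d(C,x)=\inf_{y\in C}d(y,x)$.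
   Formalization: The space X is additionally assumed complete and C nonempty; without completeness the claim fails, e.g. in the open Euclidean unit disc with C a chord for which the foot of the perpendicular from x lies outside the disc. *)

(* Defs.v *)
From HB Require Import structures.
From mathcomp Require Import all_boot all_order all_algebra.
From mathcomp Require Import all_classical all_reals all_analysis.

Set Implicit Arguments.
Unset Strict Implicit.
Unset Printing Implicit Defensive.

Import Order.TTheory GRing.Theory Num.Theory.
Import numFieldNormedType.Exports.

Local Open Scope classical_set_scope.
Local Open Scope ring_scope.

Section definitions.
Context {R : realType} {X : metricType R}.
Implicit Types (x y z : X) (g : R -> X) (C : set X).

(* Length of the inscribed polygon of the partition a :: s of [a, b]; this is
   [variation] of numfun with the distance of X in place of the norm of R. *)
Definition polygon_length (a b : R) g (s : seq R) : R :=
  let G := g \o nth b (a :: s) in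
  \sum_(0 <= n < size s) mdist (G n) (G n.+1).

Definition arc_length (a b : R) g : \bar R :=
  ereal_sup [set (polygon_length a b g s)%:E | s in itv_partition a b].

(* Arcs are continuous maps [0, 1] -> X, represented by functions R -> X whose
   values outside [0, 1] are irrelevant. *)
Definition is_arc x y g : Prop :=
  [/\ {within `[0, 1], continuous g}, g 0 = x & g 1 = y].

Definition rectifiable g : Prop := (arc_length 0 1 g < +oo)%E.

Definition geodesic x y g : Prop :=
  [/\ is_arc x y g,
      arc_length 0 1 g = (mdist x y)%:E &
      forall t, t \in `[0, 1] ->
        arc_length 0 t g = (t%:E * arc_length 0 1 g)%E].

Definition geodesically_convex C : Prop :=
  forall x y g, C x -> C y -> geodesic x y g -> g @` `[0, 1] `<=` C.

Definition dist_to C x : R := inf [set mdist y x | y in C].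

End definitions.

Section spaces.
Context {R : realType}.

Definition geodesic_length_space (X : metricType R) : Prop :=
  (forall x y : X, (mdist x y)%:E =
     ereal_inf [set arc_length 0 1 g | g in [set g | is_arc x y g /\ rectifiable g]])
  /\ (forall x y : X, exists g, geodesic x y g).

Definition busemann_p_space (p : R) (X : metricType R) : Prop :=
  geodesic_length_space X /\
  exists2 K : R, 0 < K &
    forall (x y z : X) (g : R -> X), geodesic y z g ->
      1 / (2 * K) `^ p * mdist y z `^ p
        <= 1 / 2 * (mdist x y `^ p + mdist x z `^ p) - mdist x (g (1 / 2)) `^ p.

(* The library's [completeType] would force X to be pointed. *)
Definition complete_metric (X : metricType R) : Prop :=
  forall u : nat -> X, cauchy (u @ \oo) -> exists l : X, u @ \oo --> l.

End spaces.

(* Main.v *)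
(** In a Busemann p-space, comparing [x] with the midpoint of a geodesic
    joining two points of [C] shows that points of [C] that almost realize
    [D = d(C, x)] are close to each other:
    if [d(y, x)^p <= D^p + e] and [d(z, x)^p <= D^p + e],
    then [d(y, z)^p <= (2K)^p e].
    With [e = 0] this is uniqueness; with [e -> 0] it says that minimizing
    sequences are Cauchy, and their limits are minimizers. *)

Require Import Defs.
From HB Require Import structures.
From mathcomp Require Import all_boot all_order all_algebra.
From mathcomp Require Import all_classical all_reals all_analysis.
From mathcomp Require Import lra.

Set Implicit Arguments.
Unset Strict Implicit.
Unset Printing Implicit Defensive.

Import Order.TTheory GRing.Theory Num.Theory.
Import numFieldNormedType.Exports.

Local Open Scope classical_set_scope.
Local Open Scope ring_scope.

Lemma ltr_powR_inv (R : realType) (p a b : R) :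
  0 <= p -> 0 <= b -> a `^ p < b `^ p -> a < b.
Proof.
move=> p0 b0; apply: contraTT; rewrite -!leNgt => ba.
by rewrite ge0_ler_powR// nnegrE (le_trans b0).
Qed.

Lemma powR_addl_surj (R : realType) (p a e : R) :
  0 < p -> 0 <= a -> 0 < e -> exists2 d, 0 < d & (a + d) `^ p = a `^ p + e.
Proof.
move=> p0 a0 e0; have b0 : 0 <= a `^ p + e by rewrite addr_ge0 ?powR_ge0 ?ltW.
have bE : ((a `^ p + e) `^ p^-1) `^ p = a `^ p + e.
  by rewrite -powRrM mulVf ?gt_eqF// powRr1.
exists ((a `^ p + e) `^ p^-1 - a); last by rewrite addrC subrK.
rewrite subr_gt0; apply: (@ltr_powR_inv _ p); rewrite ?powR_ge0 ?ltW//.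
by rewrite bE ltrDl.
Qed.

Section dist_to.
Context {R : realType} {X : metricType R}.
Implicit Types (C : set X) (x y : X).

Lemma dist_to_le C x y : C y -> dist_to C x <= mdist y x.
Proof.
move=> Cy; apply: ge_inf; last by exists y.
by exists 0 => _ [z _ <-]; exact: mdist_ge0.
Qed.

Lemma dist_to_ge0 C x : C !=set0 -> 0 <= dist_to C x.
Proof.
move=> [y Cy]; apply: lb_le_inf; first by exists (mdist y x), y.
by move=> _ [z _ <-]; exact: mdist_ge0.
Qed.

Lemma dist_to_adherent C x (e : R) : C !=set0 -> 0 < e ->
  exists y, C y /\ mdist y x < dist_to C x + e.
Proof.
move=> [y Cy] e0.
have [||_ [z Cz <-] zx] := @inf_lt _ [set mdist y x | y in C] (dist_to C x + e).
- by exists (mdist y x), y.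
- by rewrite ltrDl.
- by exists z.
Qed.

End dist_to.

Lemma busemann_near_minimizers (R : realType) (p : R) (X : metricType R) :
  0 < p -> busemann_p_space p X ->
  exists2 k : R, 0 < k & forall (C : set X) (x y z : X) (e : R),
    geodesically_convex C -> C y -> C z ->
    mdist y x `^ p <= dist_to C x `^ p + e ->
    mdist z x `^ p <= dist_to C x `^ p + e ->
    k * mdist y z `^ p <= e.
Proof.
move=> p0 [[_ geo] [K K0 busemann]].
(* The constant depends only on [p] and the space, so one [k] serves all [C], [x] and [e]. *)
exists (1 / (2 * K) `^ p) => [|C x y z e Cconvex Cy Cz yx zx].
  by rewrite divr_gt0// powR_gt0// mulr_gt0.
have [g gyz] := geo y z.
have Cm : C (g (1 / 2)).
  apply: (Cconvex _ _ _ Cy Cz gyz); exists (1 / 2) => //=.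
  by rewrite in_itv/=; apply/andP; split; lra.
have := busemann x y z g gyz.
have : dist_to C x `^ p <= mdist x (g (1 / 2)) `^ p.
  apply: (ge0_ler_powR (ltW p0)); rewrite ?nnegrE ?mdist_ge0//.
    by apply: dist_to_ge0; exists y.
  by rewrite metric_sym dist_to_le.
rewrite (metric_sym x y) (metric_sym x z); lra.
Qed.

Theorem theorem3p12 (R : realType) (p : R) (X : metricType R) (C : set X) (x : X)
    (hp : 2 <= p)
    (hXcomplete : complete_metric X)
    (hX : busemann_p_space p X)
    (hCconvex : geodesically_convex C)
    (hCclosed : closed C)
    (hCnonempty : C !=set0) :
  exists! xC : X,
    [/\ C xC,
        (forall y : X, C y -> mdist xC x <= mdist y x) &
        mdist xC x = dist_to C x].
Proof.
have p0 : 0 < p by lra.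
have [k k0 near_min] := busemann_near_minimizers p0 hX.
have D0 := dist_to_ge0 x hCnonempty.
have [u u_min] := choice (fun n : nat =>
  dist_to_adherent x hCnonempty (e := n.+1%:R^-1) ltac:(by rewrite invr_gt0)).
have u_near (d : R) : 0 < d -> \forall n \near \oo, mdist (u n) x < dist_to C x + d.
  move=> d0; have := near_infty_natSinv_lt (PosNum d0); apply: filterS => n /= nd.
  by rewrite (lt_trans (u_min n).2)// ltrD2l.
have u_cauchy : cauchy (u @ \oo).
  (* It suffices that each radius [e] admits a ball containing a tail of [u]; its center will be
     some [u N]. *)
  apply: cauchy_exP => e e0.
  have [d d0 dE] : exists2 d, 0 < d &
      (dist_to C x + d) `^ p = dist_to C x `^ p + k * (e / 2) `^ p.
    by apply: powR_addl_surj => //; rewrite mulr_gt0// powR_gt0// divr_gt0.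
  have [N _ uN] := u_near d d0.
  have uNp n : (N <= n)%N ->
      mdist (u n) x `^ p <= dist_to C x `^ p + k * (e / 2) `^ p.
    move=> /uN /= ux; rewrite -dE (ge0_ler_powR (ltW p0)) ?nnegrE ?mdist_ge0//.
      by rewrite addr_ge0// ltW.
    exact: ltW.
  exists (u N), N => // n Nn; rewrite /= ballEmdist /=.
  apply: (@ltr_powR_inv _ p); rewrite ?ltW//.
  have := near_min C x _ _ _ hCconvex (u_min N).1 (u_min n).1
    (uNp N (leqnn N)) (uNp n Nn).
  rewrite ler_pM2l// => /le_lt_trans; apply.
  by rewrite gt0_ltr_powR ?nnegrE ?divr_ge0 ?ltW// gtr_pMr// invf_lt1// ltr1n.
have [l ul] := hXcomplete u u_cauchy.
have Cl : C l.
  by apply: (closed_cvg _ hCclosed _ _ ul); apply: nearW => n; exact: (u_min n).1.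
have lx : mdist l x = dist_to C x.
  (* Membership in [C] gives one inequality. For the other, pass through a term [u n] close to [l]
     and nearly minimizing, each with error [e / 2]. *)
  apply/eqP; rewrite eq_le dist_to_le// andbT; apply/ler_addgt0Pl => e e0.
  have e20 : 0 < e / 2 by rewrite divr_gt0.
  have [n [lun unx]] : exists n, mdist l (u n) < e / 2 /\
      mdist (u n) x < dist_to C x + e / 2.
    apply: (@filter_ex _ \oo); apply: filterI; last exact: u_near.
    exact: (metricType_numDomainType.cvgr_dist_lt ul).
  by have := metric_triangle l (u n) x; lra.
exists l; split=> [|y [Cy _ yx]].
  by split=> // y Cy; rewrite lx dist_to_le.
apply: mdist_positivity; apply: (@powR_eq0_eq0 _ _ p).
apply/eqP; rewrite eq_le powR_ge0 andbT -(pmulr_rle0 _ k0).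
by apply: (near_min C x l y 0) => //; rewrite ?lx ?yx addr0.
Qed.
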